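(* Let $\mathfrak{c}=\{c_i\}_{i\ge1}$ be an arbitrary strictly increasing sequence of positive integers and let $F:\mathbb{C}^2\to\mathbb{C}^2$ be the corresponding Cornalba--Shiffman map. Then, as $r\to+\infty$, $$\log\mu(F,r)=\Theta\big((\log r)^2\big),$$ and for every fixed $\delta>0$, $$\zeta(F,r,\delta)\sim\log r .$$
   Context: $\log$ denotes the logarithm to base $2$. $|\cdot|$ is the Euclidean norm and $B_r$ is the closed ball of radius $r$ centered at $0$. The maximum modulus is $\mu(F,r)=\max_{B_r}|F|$. $\zeta(F,r,\delta)$ is the number of connected components of $\{|F|\le\delta\}\cap B_r$ which contain at least one zero of $F$. One writes $a(r)=\Theta(b(r))$ if $a(r)=O(b(r))$ and $b(r)=O(a(r))$ as $r\to\infty$, and $a(r)\sim b(r)$ if $\lim_{r\to\infty}a(r)/b(r)=1$. Cornalba--Shiffman map: let $g(z)=\prod_{i=1}^\infty\left(1-\frac{z}{2^i}\right)$ for $z\in\mathbb{C}$; for an integer $k\ge1$ let $g_k(z)=\prod_{i\ge1,\,i\ne k}\left(1-\frac{z}{2^i}\right)$; for a positive integer $c$ let $P_c(w)=\prod_{j=1}^c\left(w-\frac1j\right)$. Given a strictly increasing sequence of positive integers $\mathfrak{c}=\{c_i\}_{i\ge 1}$, set $f(z,w)=\sum_{i=1}^\infty 2^{-c_i^2}g_i(z)P_{c_i}(w)$ and $F(z,w)=(g(z),f(z,w))$. All products and sums converge uniformly on compact sets, so $F:\mathbb{C}^2\to\mathbb{C}^2$ is holomorphic. *)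

(* Defs.v *)
From mathcomp Require Import all_boot all_order all_algebra.
From mathcomp Require Import all_classical all_reals all_analysis.
From mathcomp Require Import finmap complex.

Set Implicit Arguments.
Unset Strict Implicit.
Unset Printing Implicit Defensive.

Import Order.TTheory GRing.Theory Num.Theory.
Import numFieldNormedType.Exports.

Local Open Scope classical_set_scope.
Local Open Scope ring_scope.

(* R[i], viewed abstractly so that it receives the topology that
   MathComp-Analysis puts on any numeric field, i.e., the one of its modulus.
   [CC R * CC R] then carries the product topology. *)
Definition CC (R : realType) : numClosedFieldType := R[i].

Definition log2 (R : realType) (x : R) : R := ln x / ln 2.

(* The library norm on a product is the sup norm, so the Euclidean norm is
   spelled out; [normc] is the R-valued modulus. *)
Definition enorm (R : realType) (p : CC R * CC R) : R :=
  Num.sqrt (Normc.normc p.1 ^+ 2 + Normc.normc p.2 ^+ 2).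

Definition eball (R : realType) (r : R) : set (CC R * CC R) :=
  [set p | enorm p <= r].

(* For continuous F and 0 <= r this supremum is attained, hence a maximum. *)
Definition maxmod (R : realType) (F : CC R * CC R -> CC R * CC R) (r : R) : R :=
  sup [set enorm (F p) | p in eball r].

Definition components (T : topologicalType) (A : set T) : set (set T) :=
  [set connected_component A p | p in A].

Definition sublevel (R : realType) (F : CC R * CC R -> CC R * CC R)
    (r delta : R) : set (CC R * CC R) :=
  [set p | enorm (F p) <= delta] `&` eball r.

(* [fset_set] is empty on infinite sets, so the count is 0 if there are
   infinitely many such components; a nonzero value entails finiteness. *)
Definition coarse_zeros (R : realType) (F : CC R * CC R -> CC R * CC R)
    (r delta : R) : nat :=
  #|` fset_set [set K | components (sublevel F r delta) K /\
                        exists2 p, K p & F p = (0, 0)] |.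

Definition CS_g (R : realType) (z : CC R) : CC R :=
  \big[*%R/1]_(1 <= i <oo) (1 - z / 2 ^+ i).

Definition CS_gk (R : realType) (k : nat) (z : CC R) : CC R :=
  \big[*%R/1]_(1 <= i <oo | i != k) (1 - z / 2 ^+ i).

Definition CS_P (R : realType) (c : nat) (w : CC R) : CC R :=
  \prod_(1 <= j < c.+1) (w - j%:R^-1).

Definition CS_f (R : realType) (c : nat -> nat) (z w : CC R) : CC R :=
  \big[+%R/0]_(1 <= i <oo) (2 ^- (c i ^ 2) * CS_gk i z * CS_P (c i) w).

(* The sequence is indexed from 1: the value c 0 is never used. *)
Definition CS_map (R : realType) (c : nat -> nat) (p : CC R * CC R) :
    CC R * CC R :=
  (CS_g p.1, CS_f c p.1 p.2).

(* The Landau notations only accept filters declared as a [filter_on]. *)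
Canonical pinfty_filter_on (R : numFieldType) := FilterType (pinfty_nbhs R) _.

Definition Theta_pinfty (R : realType) (a b : R -> R) : Prop :=
  a =O_ (pinfty_nbhs R) b /\ b =O_ (pinfty_nbhs R) a.

Definition sim_pinfty (R : realType) (a b : R -> R) : Prop :=
  a r / b r @[r --> +oo] --> (1 : R).

(* Main.v *)
Require Import Defs.
From mathcomp Require Import all_boot all_order all_algebra.
From mathcomp Require Import all_classical all_reals all_analysis.
From mathcomp Require Import finmap complex ring lra zify.

(** The zeros of F are the points (2^k, 1/j) with k >= 1 and 1 <= j <= c_k: the
    first coordinate of F vanishes exactly on the slices z = 2^k, and on such a
    slice every term of the series f except the k-th one vanishes, which leaves
    f(2^k, w) = 2^(-c_k^2) g_k(2^k) P_(c_k)(w) with g_k(2^k) <> 0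
    ([CS_map_eq0]).

    Everything quantitative comes from two estimates on g.  Let T(m) =
    m(m+1)/2.  If |z| <= 2^m, then g and all the g_k, as well as their partial
    products, are at most 3 * 2^T(m) at z ([normc_dyadic_prod_le]).  On the
    circle |z| = 3 * 2^m, which runs between the zeros 2^(m+1) and 2^(m+2),
    |g| is at least 2^T(m) / 32 ([normc_CS_g_circle_ge]).  Both reduce to
    real arguments, -|z| for the upper bound and |z| for the lower one, where
    they follow by induction on m from the functional equation
    g(2x) = (1 - x) g(x).

    Growth.  Since c (m+1) <= c^2 + (m+1)^2, the factor 2^(-c_i^2) absorbs
    P_(c_i) up to a factor 2^((m+1)^2), and c_i >= i makes the series f
    converge geometrically; so log |F| = O(m^2) on the ball of radius 2^m - 1
    ([enorm_CS_map_le]).  The lower bound is that of |g| at z = 3 * 2^m.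

    Counting.  Let m be the integral part of log r; only the slices
    z = 2^k with k <= m meet the ball of radius r.
    - On the slice z = 2^k, for w in [0, 1], |F| is at most
      2^(-c_k^2) |g_k(2^k)| <= 3 * 2^(T(k) - k^2), which tends to 0 with k.
      Hence for k >= k0 the whole segment from (2^k, 1/c_k) to (2^k, 1) lies
      in {|F| <= delta}, and all the zeros of the slice that lie in the ball
      are in one component.  The remaining slices contribute at most
      c_1 + ... + c_(k0) components, a number that does not depend on r
      ([zero_components_sub_seq]).
    - For n >= k1, |g| > delta on the circle |z| = 3 * 2^n, so that
      {|F| <= delta} avoids the hypersurface |z| = 3 * 2^n in C^2, and no
      connected subset joins two different slices 2^k, 2^l with k, l > k1
      ([zero_components_separated]).
    Together, the count differs from log r by a bounded amount
    ([coarse_zeros_log2]), which is more than asymptotic equivalence. *)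

Set Implicit Arguments.
Unset Strict Implicit.
Unset Printing Implicit Defensive.

Import Order.TTheory GRing.Theory Num.Theory.
Import numFieldNormedType.Exports.

Local Open Scope classical_set_scope.
Local Open Scope ring_scope.

Local Notation normc := (@Normc.normc _).

(** * The modulus on [CC R] *)

Section Modulus.
Variable R : realType.
Implicit Types (z w : CC R) (x : R).

(** The embedding of the reals, with codomain [CC R] so that the topology of
    [CC R] is the one inferred. *)
Definition toCC (x : R) : CC R := real_complex R x.

Lemma toCCB : {morph toCC : x y / x - y}.
Proof. exact: rmorphB. Qed.

Lemma toCC_nat n : toCC n%:R = n%:R.
Proof. exact: rmorph_nat. Qed.

Lemma toCC_lt x y : (toCC x < toCC y) = (x < y).
Proof. exact: ltcR. Qed.

Lemma toCC_normc z : toCC (normc z) = `|z|.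
Proof. by case: z. Qed.

(** The radii of the balls of [CC R] are positive elements of [CC R], which the
    order of the complex numbers forces to be real. *)
Lemma gt0_toCC (e : CC R) : 0 < e -> exists2 x, 0 < x & e = toCC x.
Proof.
case: e => a b /[dup] ab_gt0; rewrite (ltcE (0 : R[i])) /= => /andP[/eqP b0 a_gt0].
by exists a => //; rewrite b0.
Qed.

Lemma normc_ge0 z : 0 <= normc z.
Proof. by case: z => a b /=; exact: sqrtr_ge0. Qed.

Lemma normcM z w : normc (z * w) = normc z * normc w.
Proof. exact: Normc.normcM. Qed.

Lemma normcV z : normc z^-1 = (normc z)^-1.
Proof. exact: Normc.normcV. Qed.

Lemma normcD z w : normc (z + w) <= normc z + normc w.
Proof. exact: le_normcD. Qed.

Lemma normcN z : normc (- z) = normc z.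
Proof. exact: normcN. Qed.

Lemma normcBC z w : normc (z - w) = normc (w - z).
Proof. by rewrite -normcN opprB. Qed.

Lemma normcB z w : normc (z - w) <= normc z + normc w.
Proof. by rewrite -[normc w]normcN normcD. Qed.

Lemma lerB_normc z w : normc z - normc w <= normc (z - w).
Proof. by rewrite lerBlDr -{1}[z](subrK w) normcD. Qed.

Lemma normc0 : normc (0 : CC R) = 0.
Proof. exact: Normc.normc0. Qed.

Lemma normc1 : normc (1 : CC R) = 1.
Proof. exact: Normc.normc1. Qed.

Lemma normc_eq0 z : (normc z == 0) = (z == 0).
Proof.
by apply/eqP/eqP => [/Normc.eq0_normc//|->]; exact: normc0.
Qed.

Lemma normc_real x : normc (toCC x) = `|x|.
Proof. by rewrite /= expr0n addr0 sqrtr_sqr. Qed.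

Lemma normc_nat n : normc (n%:R : CC R) = n%:R.
Proof. by rewrite -toCC_nat normc_real normr_nat. Qed.

Lemma normcX z n : normc (z ^+ n) = normc z ^+ n.
Proof. by elim: n => [|n IH]; rewrite ?normc1// !exprS normcM IH. Qed.

Lemma normc_prod (I : Type) (s : seq I) (P : pred I) (F : I -> CC R) :
  normc (\prod_(i <- s | P i) F i) = \prod_(i <- s | P i) normc (F i).
Proof. by apply: (big_morph (@Normc.normc R) normcM normc1). Qed.

Lemma normc_sum (I : Type) (s : seq I) (P : pred I) (F : I -> CC R) :
  normc (\sum_(i <- s | P i) F i) <= \sum_(i <- s | P i) normc (F i).
Proof.
elim/big_rec2: _ => [|i x y _ le_yx]; first by rewrite normc0.
by apply: le_trans (normcD _ _) _; rewrite lerD2l.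
Qed.

Lemma ler_Re_normc z : `|complex.Re z| <= normc z.
Proof.
by case: z => a b /=; rewrite -sqrtr_sqr ler_wsqrtr // lerDl sqr_ge0.
Qed.

Lemma ler_Im_normc z : `|complex.Im z| <= normc z.
Proof.
by case: z => a b /=; rewrite -sqrtr_sqr ler_wsqrtr // lerDr sqr_ge0.
Qed.

(** The topology of [CC R] is given by a norm with values in [CC R]; this
    rephrases convergence with real moduli and real radii. *)
Lemma cvg_normcP (T : Type) (F : set_system T) (FF : Filter F) (u : T -> CC R)
    (l : CC R) :
  u @ F --> l <-> (forall e : R, 0 < e -> \forall t \near F, normc (l - u t) < e).
Proof.
split=> [/cvgrPdist_lt ul e e_gt0|ul].
  have := ul (toCC e); rewrite (toCC_lt 0) => /(_ e_gt0).
  by apply: filterS => t; rewrite -toCC_normc toCC_lt.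
apply/cvgrPdist_lt => _ /gt0_toCC[e e_gt0 ->].
by apply: filterS (ul e e_gt0) => t; rewrite -toCC_normc toCC_lt.
Qed.

Lemma normc_continuous : continuous (normc : CC R -> R).
Proof.
move=> z; apply/(cvgrPdist_lt (FF := nbhs_filter z)) => e e_gt0.
have := (cvg_normcP (nbhs_filter z) id z).1 cvg_id e e_gt0.
apply: filterS => w; apply: le_lt_trans.
by rewrite ler_norml lerB_normc andbT lerNl opprB normcBC lerB_normc.
Qed.

Lemma toCC_continuous : continuous toCC.
Proof.
move=> x; apply/(cvg_normcP (nbhs_filter x)) => e e_gt0.
have := (cvgrPdist_lt (FF := nbhs_filter x) id x).1 cvg_id e e_gt0.
by apply: filterS => y; rewrite -toCCB normc_real.
Qed.

Lemma cvg_normc (u : nat -> CC R) (l : CC R) :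
  u n @[n --> \oo] --> l -> normc (u n) @[n --> \oo] --> normc l.
Proof. by move=> ul; apply: continuous_cvg ul; exact: normc_continuous. Qed.

(** A divergent sequence has limit 0 by convention, and 0 obeys the bound too. *)
Lemma normc_lim_le (u : nat -> CC R) (B : R) :
  (forall n, normc (u n) <= B) -> normc (lim (u n @[n --> \oo])) <= B.
Proof.
move=> uB; have [/cvg_normc nul|dcu] := pselect (cvg (u n @[n --> \oo])).
  by apply: (closed_cvg (fun y => y <= B)) nul; [exact: closed_le|exact: nearW].
by rewrite dvgP// normc0 (le_trans (normc_ge0 (u 0%N))).
Qed.

Lemma normc_lim_ge (u : nat -> CC R) (B : R) : cvgn u ->
  (\forall n \near \oo, B <= normc (u n)) -> B <= normc (lim (u n @[n --> \oo])).
Proof.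
move=> /cvg_normc nul uB.
by apply: (closed_cvg (fun y => B <= y)) nul; first exact: closed_ge.
Qed.

Lemma cvg_geometric_increments (x : nat -> R) (C : R) :
  (forall n, `|x n.+1 - x n| <= C / 2 ^+ n) -> cvgn x.
Proof.
move=> xC; have xE n : x n = x 0%N + series (telescope x) n.
  by rewrite [LHS]eq_sum_telescope.
suff cx : cvgn (series (telescope x)).
  by rewrite (_ : x = cst (x 0%N) \+ series (telescope x)); [
    apply: is_cvgD => //; exact: is_cvg_cst | apply/funext => n; exact: xE].
apply: normed_cvg; apply: (@series_le_cvg _ _ (geometric C 2^-1)).
- by move=> n /=.
- by move=> n; rewrite /= exprVn (le_trans (normr_ge0 _) (xC n)).
- by move=> n; rewrite /= exprVn; exact: xC.
- by apply: is_cvg_geometric_series; rewrite ger0_norm ?invf_lt1; lra.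
Qed.

(** The completeness of [CC R] enters only through this criterion, which
    reduces to the real one on real and imaginary parts. *)
Lemma cvg_geometric_incrementsC (u : nat -> CC R) (C : R) :
  (forall n, normc (u n.+1 - u n) <= C / 2 ^+ n) -> cvgn u.
Proof.
move=> uC.
have /cvg_ex[a ua] : cvgn (fun n => complex.Re (u n)).
  apply: (@cvg_geometric_increments _ C) => n; apply: le_trans (uC n).
  by apply: le_trans (ler_Re_normc _); case: (u n.+1) (u n) => [? ?] [].
have /cvg_ex[b ub] : cvgn (fun n => complex.Im (u n)).
  apply: (@cvg_geometric_increments _ C) => n; apply: le_trans (uC n).
  by apply: le_trans (ler_Im_normc _); case: (u n.+1) (u n) => [? ?] [].
apply/cvg_ex; exists (Complex a b); apply/cvg_normcP => e e_gt0.
have e2_gt0 : 0 < e / 2 by rewrite divr_gt0.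
move/cvgrPdist_lt: ua => /(_ _ e2_gt0) ua; move/cvgrPdist_lt: ub => /(_ _ e2_gt0) ub.
near=> n.
have ua_n : `|a - complex.Re (u n)| < e / 2 by near: n.
have ub_n : `|b - complex.Im (u n)| < e / 2 by near: n.
have -> : (Complex a b : CC R) - u n = toCC (a - complex.Re (u n)) +
    Complex 0 (b - complex.Im (u n)).
  by case: (u n) => c d; congr Complex; rewrite /= ?addr0 ?add0r.
apply: le_lt_trans (normcD _ _) _; rewrite normc_real /= expr0n add0r sqrtr_sqr.
by rewrite [ltRHS](splitr e) ltrD.
Unshelve. all: by end_near. Qed.

End Modulus.

(** * Dyadic products *)

Section DyadicProducts.
Variable R : realType.
Implicit Types (x : R) (m n : nat).

(** The finite form of the functional equation of the dyadic products: doubling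
    the argument only adds a factor in front. *)
Lemma prod_dyadic_shift (f : R -> R) x n :
  \prod_(1 <= i < n.+2) f (2 * x / 2 ^+ i) =
  f x * \prod_(1 <= i < n.+1) f (x / 2 ^+ i).
Proof.
rewrite big_nat_recl //= big_add1; congr (f _ * _); first by field.
rewrite big_add1 /=; apply: eq_bigr => i _; congr f.
by rewrite exprS invfM; field; rewrite expf_neq0.
Qed.

(** The product increases with [n], so induction needs the sharper bound
    3 (1 - 2^(-k)) on the first k factors, valid from k = 1 on. *)
Lemma prod_1Dhalf_le n :
  \prod_(1 <= i < n) (1 + 1 / 2 ^+ i) <= 3 :> R.
Proof.
case: n => [|n]; first by rewrite big_geq // ler1n.
suff H k : \prod_(1 <= i < k.+2) (1 + 1 / 2 ^+ i) <= 3 * (1 - 1 / 2 ^+ k.+1) :> R.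
  case: n => [|n]; first by rewrite big_geq // ler1n.
  apply: le_trans (H n) _; rewrite ler_piMr // gerBl divr_ge0.
elim: k => [|k IH]; first by rewrite big_nat1; lra.
rewrite big_nat_recr //=; set t : R := 1 / 2 ^+ k.+1 in IH *.
have -> : 1 / 2 ^+ k.+2 = t / 2 :> R.
  by rewrite /t exprSr invfM; field; rewrite expf_neq0.
have t_ge0 : 0 <= t by rewrite divr_ge0 // exprn_ge0.
apply: le_trans (_ : 3 * (1 - t) * (1 + t / 2) <= _); last by nra.
by rewrite ler_wpM2r //; lra.
Qed.

Lemma prod_dyadic_le m n :
  \prod_(1 <= i < n) (1 + 2 ^+ m / 2 ^+ i) <= 3 * 2 ^+ 'C(m.+1, 2) :> R.
Proof.
have ge1 k : 1 <= 3 * 2 ^+ k :> R.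
  by rewrite (le_trans (ler1n _ 3)) // ler_peMr // exprn_ege1 // ler1n.
elim: m n => [|m IH] n; first by rewrite expr0 mulr1 prod_1Dhalf_le.
case: n => [|[|n]]; try by rewrite big_geq.
rewrite exprS (prod_dyadic_shift (fun y => 1 + y)).
rewrite (binS m.+1) bin1 exprD [2 ^+ 'C(_, _) * _]mulrC mulrCA.
apply: ler_pM (IH _) => //.
- by apply: prodr_ge0 => i _; rewrite addr_ge0 // divr_ge0 ?exprn_ge0.
- have : 1 <= 2 ^+ m :> R by rewrite exprn_ege1 // ler1n.
  by rewrite exprS; lra.
Qed.

(** Weierstrass' inequality: a product of factors 1 - a_i is at least one minus
    the sum of the a_i, here the tail of a geometric series.  Selecting the
    factors with [P] can only increase the product. *)
Lemma prod_tail_ge (P : pred nat) x N n : 0 <= x -> x * 2 <= 2 ^+ N ->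
  1 - x * 2 / 2 ^+ N <= \prod_(N <= i < n | P i) `|1 - x / 2 ^+ i|.
Proof.
move=> x_ge0 xN; have p2_gt0 k : 0 < 2 ^+ k :> R by rewrite exprn_gt0.
have [leNn|ltnN] := leqP N n; last first.
  by rewrite big_geq ?(ltnW ltnN) // gerBl divr_ge0 ?mulr_ge0 // ltW.
(* Keep the part of the geometric sum that the first k factors do not use. *)
suff H k : 1 - x * 2 / 2 ^+ N + x * 2 / 2 ^+ (N + k) <=
    \prod_(N <= i < N + k | P i) `|1 - x / 2 ^+ i|.
  rewrite -(subnKC leNn); apply: le_trans (H _).
  by rewrite lerDl divr_ge0 ?mulr_ge0 // ltW.
set a := x * 2 / 2 ^+ N.
have a_le1 : a <= 1 by rewrite ler_pdivrMr ?mul1r.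
elim: k => [|k IH]; first by rewrite addn0 subrK big_geq.
rewrite addnS big_mkcond big_nat_recr ?leq_addr //= -big_mkcond /=.
have -> : x / 2 ^+ (N + k) = x * 2 / 2 ^+ (N + k).+1.
  by rewrite exprS invfM; field; rewrite expf_neq0.
have : x * 2 / 2 ^+ (N + k) = 2 * (x * 2 / 2 ^+ (N + k).+1).
  by rewrite exprS invfM; field; rewrite expf_neq0.
move: IH; set b := _ / 2 ^+ (N + k); set t := _ / _ => IH bE.
have t_ge0 : 0 <= t by rewrite divr_ge0 ?mulr_ge0 // ltW.
have b_lea : b <= a.
  by rewrite ler_wpM2l ?mulr_ge0 // lef_pV2 ?posrE // ler_weXn2l ?leq_addr ?ler1n.
set p := \prod_(_ <= i < _ | _) _ in IH *.
have : 1 - a + t <= p * (1 - t) by nra.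
have p_ge0 : 0 <= p by apply: prodr_ge0.
move=> /le_trans; apply; rewrite ler_wpM2l //.
by case: (P _); [exact: ler_norm|lra].
Qed.

(** For m = 0 the factors are 1/2, 1/4 and a tail that is at least 1/4.  Passing
    from m to m + 1 adds the factor 3 * 2^m - 1, which is at least 2^(m+1). *)
Lemma prod_between_zeros_ge m n :
  2 ^+ 'C(m.+1, 2) / 32 <=
  \prod_(1 <= i < (n + m).+1) `|1 - 3 * 2 ^+ m / 2 ^+ i| :> R.
Proof.
elim: m n => [|m IH] n.
  rewrite addn0; under eq_bigr do rewrite expr0 mulr1.
  rewrite bin_small // expr0 mul1r.
  case: n => [|[|n]]; first by rewrite big_geq //; lra.
    by rewrite big_nat1 expr1 ler_normr; apply/orP; right; lra.
  rewrite (@big_cat_nat _ _ _ 3) //=.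
  rewrite big_ltn // big_nat1.
  have := @prod_tail_ge xpredT 3 3 n.+3.
  have -> : `|1 - 3 / 2 ^+ 1| = 2^-1 :> R.
    by rewrite distrC ger0_norm; lra.
  have -> : `|1 - 3 / 2 ^+ 2| = 4^-1 :> R.
    by rewrite ger0_norm; lra.
  set p := \prod_(_ <= i < _) _; have -> : 2 ^+ 3 = 8 :> R by ring.
  by move=> /(_ _ _)H; have : 1 / 4 <= p; [apply: le_trans (H _ _); lra|lra].
rewrite addnS exprS mulrCA (prod_dyadic_shift (fun y => `|1 - y|)).
rewrite (binS m.+1) bin1 exprD [2 ^+ 'C(_, _) * _]mulrC -mulrA.
apply: ler_pM; rewrite ?IH ?exprn_ge0 ?divr_ge0 //.
have : 1 <= 2 ^+ m :> R by rewrite exprn_ege1 // ler1n.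
by rewrite distrC exprS => H; apply: le_trans (ler_norm _); lra.
Qed.

End DyadicProducts.

(** * The infinite products *)

Section CanonicalProducts.
Variable R : realType.
Implicit Types (P : pred nat) (z : CC R) (m n k : nat).

(** Partial products of g for a true [P], of g_k for [P] the complement of k. *)
Definition dyadic_prod P z n : CC R := \prod_(1 <= i < n | P i) (1 - z / 2 ^+ i).

Lemma normc_div2X z i : normc (z / 2 ^+ i) = normc z / 2 ^+ i.
Proof. by rewrite normcM normcV normcX normc_nat. Qed.

Lemma normc_factor_le z i : normc (1 - z / 2 ^+ i) <= 1 + normc z / 2 ^+ i.
Proof. by rewrite (le_trans (normcB _ _))// normc1 normc_div2X. Qed.

Lemma normc_factor_ge z i : `|1 - normc z / 2 ^+ i| <= normc (1 - z / 2 ^+ i).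
Proof.
rewrite -normc_div2X -(normc1 R) ler_norml lerB_normc andbT.
by rewrite lerNl opprB normcBC lerB_normc.
Qed.

(** The factors that [P] leaves out can be put back in the bound, because
    1 + 2^m / 2^i is at least 1. *)
Lemma normc_dyadic_prod_le P z m n : normc z <= 2 ^+ m ->
  normc (dyadic_prod P z n) <= 3 * 2 ^+ 'C(m.+1, 2).
Proof.
move=> zm; apply: le_trans (prod_dyadic_le R m n).
rewrite normc_prod big_mkcond /=; apply: ler_prod => i _.
have p_ge0 y : 0 <= y -> 0 <= y / 2 ^+ i :> R by move=> ?; rewrite divr_ge0 ?exprn_ge0.
have le_i : 1 + normc z / 2 ^+ i <= 1 + 2 ^+ m / 2 ^+ i.
  by rewrite lerD2l ler_wpM2r // invr_ge0 exprn_ge0.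
case: ifP => _; first by rewrite normc_ge0 (le_trans (normc_factor_le _ _)).
by rewrite ler01 lerDl p_ge0 // exprn_ge0.
Qed.

Lemma exists_pow2_ge (x : R) : exists m, x <= 2 ^+ m.
Proof.
exists (Num.truncn x).+1; apply: le_trans (ltW (truncnS_gt x)) _.
by rewrite -natrX ler_nat ltnW // ltn_expl.
Qed.

(** The partial products are bounded and the [n]-th factor is within |z| / 2^n
    of 1, so their increments decrease geometrically. *)
Lemma cvg_dyadic_prod P z : cvgn (dyadic_prod P z).
Proof.
have [m zm] := exists_pow2_ge (normc z).
set B : R := 3 * 2 ^+ 'C(m.+1, 2).
apply: (@cvg_geometric_incrementsC _ _ (B * 2 ^+ m)) => n.
have B_ge0 : 0 <= B * 2 ^+ m / 2 ^+ n by rewrite divr_ge0 ?mulr_ge0 ?exprn_ge0.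
rewrite /dyadic_prod; case: n => [|n] in B_ge0 *.
  by rewrite !big_geq // subrr normc0.
rewrite big_mkcond big_nat_recr //= -big_mkcond /=.
case: ifP => _; last by rewrite mulr1 subrr normc0.
rewrite mulrBr mulr1 addrAC subrr sub0r normcN normcM normc_div2X -mulrA.
apply: ler_pM; rewrite ?normc_ge0 ?divr_ge0 ?normc_ge0 ?exprn_ge0//.
- exact: normc_dyadic_prod_le.
- by rewrite ler_wpM2r // invr_ge0 exprn_ge0.
Qed.

Lemma dyadic_prod_cat P z N n : (0 < N <= n)%N ->
  dyadic_prod P z n =
  dyadic_prod P z N * \prod_(N <= i < n | P i) (1 - z / 2 ^+ i).
Proof. by move=> /andP[N_gt0 leNn]; rewrite -big_cat_nat. Qed.

(** From a rank on, the remaining factors have a product of modulus at least 1/2,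
    so the partial products stay away from 0 once none of the first factors
    vanishes. *)
Lemma lim_dyadic_prod_neq0 P z :
  (forall i, (0 < i)%N -> P i -> z != 2 ^+ i) -> limn (dyadic_prod P z) != 0.
Proof.
move=> zP; have [m zm] := exists_pow2_ge (normc z * 4).
have B_gt0 : 0 < normc (dyadic_prod P z m.+1) / 2.
  rewrite divr_gt0 // lt0r normc_ge0 normc_eq0 andbT.
  rewrite /dyadic_prod prodf_seq_neq0; apply/allP => i.
  rewrite mem_index_iota => /andP[i_gt0 _]; apply/implyP => Pi.
  rewrite subr_eq0; apply: contraNneq (zP i i_gt0 Pi) => z1.
  have /(congr1 ( *%R^~ (2 ^+ i))) := z1.
  by rewrite mul1r divfK ?expf_neq0 ?pnatr_eq0 // => <-.
rewrite -normc_eq0 gt_eqF // (lt_le_trans B_gt0) //.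
apply: normc_lim_ge; first exact: cvg_dyadic_prod.
exists m.+1 => // n /= ltmn; rewrite -/(dyadic_prod P z n) (@dyadic_prod_cat P z m.+1 n) //.
rewrite normcM ler_wpM2l ?normc_ge0 // normc_prod.
have zm' : normc z * 4 <= 2 ^+ m.+1.
  by rewrite (le_trans zm) // ler_weXn2l ?ler1n.
have p_gt0 : 0 < 2 ^+ m.+1 :> R by rewrite exprn_gt0.
apply: (@le_trans _ _ (1 - normc z * 2 / 2 ^+ m.+1)).
  rewrite lerBrDr -lerBrDl ler_pdivrMr //; lra.
apply: le_trans (_ : \prod_(m.+1 <= i < n | P i) `|1 - normc z / 2 ^+ i| <= _).
  by apply: prod_tail_ge; [exact: normc_ge0|have := normc_ge0 z; lra].
by apply: ler_prod => i _; rewrite normr_ge0 normc_factor_ge.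
Qed.

Lemma dyadic_prod_root P k n : (0 < k < n)%N -> P k ->
  dyadic_prod P (2 ^+ k) n = 0.
Proof.
move=> kn Pk; apply/eqP; rewrite prodf_seq_eq0; apply/hasP; exists k.
  by rewrite mem_index_iota.
by rewrite Pk divff ?subrr ?eqxx // expf_neq0 // pnatr_eq0.
Qed.

Lemma lim_dyadic_prod_root P k : (0 < k)%N -> P k ->
  limn (dyadic_prod P (2 ^+ k)) = 0.
Proof.
move=> k_gt0 Pk; apply: cvg_lim => //; apply: cvg_near_cst.
by exists k.+1 => // n /= ltkn; rewrite dyadic_prod_root // k_gt0.
Qed.

Lemma CS_gE z : CS_g z = limn (dyadic_prod xpredT z).
Proof. by []. Qed.

Lemma CS_g_eq0 z : CS_g z = 0 <-> exists2 k, (0 < k)%N & z = 2 ^+ k.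
Proof.
rewrite CS_gE; split=> [gz|[k k_gt0 ->]]; last exact: lim_dyadic_prod_root.
apply/not_exists2P => zk; have /eqP[] : limn (dyadic_prod xpredT z) != 0 => //.
by apply: lim_dyadic_prod_neq0 => i i_gt0 _; apply/eqP => zi; case: (zk i).
Qed.

Lemma normc_CS_g_le z m : normc z <= 2 ^+ m ->
  normc (CS_g z) <= 3 * 2 ^+ 'C(m.+1, 2).
Proof. by move=> zm; apply: normc_lim_le => n; exact: normc_dyadic_prod_le. Qed.

Lemma normc_CS_gk_le k z m : normc z <= 2 ^+ m ->
  normc (CS_gk k z) <= 3 * 2 ^+ 'C(m.+1, 2).
Proof. by move=> zm; apply: normc_lim_le => n; exact: normc_dyadic_prod_le. Qed.

Lemma CS_gk_root i k : (0 < k)%N -> k != i -> CS_gk i (2 ^+ k : CC R) = 0.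
Proof. by move=> ? ?; exact: lim_dyadic_prod_root. Qed.

Lemma CS_gk_neq0 k : CS_gk k (2 ^+ k : CC R) != 0.
Proof.
apply: lim_dyadic_prod_neq0 => i _; apply: contraNneq => /(congr1 normc).
rewrite !normcX normc_nat => ki.
by rewrite (@ieexprIn R 2 _ _ _ _ ki) ?pnatr_eq1.
Qed.

(** The circle separates the zeros 2^(m+1) and 2^(m+2) of g.  The factor of g
    with index i is smallest in modulus at the positive point of the circle. *)
Lemma normc_CS_g_circle_ge z m : normc z = 3 * 2 ^+ m ->
  2 ^+ 'C(m.+1, 2) / 32 <= normc (CS_g z).
Proof.
move=> zm; apply: normc_lim_ge; first exact: cvg_dyadic_prod.
exists m.+1 => // n /= ltmn.
have -> : n = (n - m.+1 + m).+1 by lia.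
rewrite normc_prod; apply: le_trans (prod_between_zeros_ge R m _) _.
by apply: ler_prod => i _; rewrite normr_ge0 -zm normc_factor_ge.
Qed.

End CanonicalProducts.

(** * Zeros and size of the Cornalba-Shiffman map *)

Section CornalbaShiffman.
Variable R : realType.
Implicit Types (z w : CC R) (i j k m n : nat) (t r : R).

Lemma CS_P_eq0 n w :
  CS_P n w = 0 <-> exists2 j, (0 < j <= n)%N & w = toCC (j%:R^-1).
Proof.
have toCCV j : toCC (j%:R^-1 : R) = j%:R^-1.
  by rewrite /toCC fmorphV; congr (_^-1); exact: toCC_nat.
split=> [/eqP|[j jn ->]].
  rewrite prodf_seq_eq0 => /hasP[j]; rewrite mem_index_iota ltnS => jn.
  by rewrite subr_eq0 => /eqP ->; exists j.
apply/eqP; rewrite prodf_seq_eq0; apply/hasP; exists j.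
  by rewrite mem_index_iota ltnS.
by rewrite toCCV subrr eqxx.
Qed.

Lemma normc_CS_P_le n w : normc (CS_P n w) <= (1 + normc w) ^+ n.
Proof.
rewrite normc_prod -[n in leRHS]subn0 -subSS -prodr_const_nat big_nat_cond.
rewrite [leRHS]big_nat_cond.
apply: ler_prod => j /andP[/andP[j_gt0 _] _]; rewrite normc_ge0 /=.
apply: le_trans (normcB _ _) _; rewrite addrC lerD2r normcV normc_nat.
by rewrite invf_le1 ?ler1n ?ltr0n.
Qed.

Lemma normc_CS_P_le1 n t : 0 <= t <= 1 -> normc (CS_P n (toCC t)) <= 1.
Proof.
move=> t01; rewrite normc_prod.
rewrite [leRHS](_ : _ = \prod_(1 <= j < n.+1) 1); last by rewrite big1_eq.
rewrite big_nat_cond [leRHS]big_nat_cond.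
apply: ler_prod => j /andP[/andP[j_gt0 _] _]; rewrite normc_ge0 /=.
have -> : toCC t - j%:R^-1 = toCC (t - j%:R^-1).
  by rewrite toCCB /toCC fmorphV; congr (_ - _^-1); rewrite -toCC_nat.
rewrite normc_real ler_norml.
have : 0 <= (j%:R^-1 : R) <= 1 by rewrite invr_ge0 ler0n invf_le1 ?ler1n ?ltr0n.
by lra.
Qed.

Section Map.
Variable c : nat -> nat.

(** For i <> k, g_i keeps the factor of index k, which vanishes at 2^k. *)
Lemma CS_f_pow2 k w : (0 < k)%N ->
  CS_f c (2 ^+ k) w = 2 ^- (c k ^ 2) * CS_gk k (2 ^+ k) * CS_P (c k) w.
Proof.
move=> k_gt0; apply: cvg_lim => //; apply: cvg_near_cst.
exists k.+1 => // n /= ltkn; apply/eqP.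
rewrite (bigD1_seq k) ?mem_index_iota ?iota_uniq ?k_gt0 //= big1 ?addr0 // => i ik.
by rewrite CS_gk_root 1?eq_sym // mulr0 mul0r.
Qed.

Lemma CS_map_eq0 (p : CC R * CC R) : CS_map c p = (0, 0) <->
  exists k j, [/\ (0 < k)%N, (0 < j <= c k)%N & p = (2 ^+ k, toCC j%:R^-1)].
Proof.
case: p => z w; rewrite /CS_map /=; split=> [[/CS_g_eq0[k k_gt0 ->]]|].
  rewrite CS_f_pow2 // => /eqP; rewrite !mulf_eq0 invr_eq0 expf_eq0 pnatr_eq0.
  rewrite andbF (negPf (CS_gk_neq0 _ _)) /= => /eqP/CS_P_eq0[j jc ->].
  by exists k, j.
move=> [k [j [k_gt0 jc [-> ->]]]]; rewrite CS_f_pow2 //.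
congr (_, _); first by apply/CS_g_eq0; exists k.
by rewrite (CS_P_eq0 _ _).2 ?mulr0 //; exists j.
Qed.

Hypothesis c_gt0 : forall i : nat, (1 <= i)%N -> (0 < c i)%N.
Hypothesis c_incr : forall i j : nat, (1 <= i)%N -> (i < j)%N -> (c i < c j)%N.

(** All that the estimates retain from the monotonicity of [c]. *)
Lemma leq_c i : (0 < i)%N -> (i <= c i)%N.
Proof.
elim: i => // -[_ _|i IH _]; first exact: c_gt0.
by apply: leq_ltn_trans (IH _) (c_incr _ _).
Qed.

Lemma sum_halves_le1 n : \sum_(1 <= i < n) 2 ^- i <= 1 :> R.
Proof.
case: n => [|n]; first by rewrite big_geq.
suff -> : \sum_(1 <= i < n.+1) 2 ^- i = 1 - 2 ^- n :> R.
  by rewrite gerBl invr_ge0 exprn_ge0.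
elim: n => [|n IH]; first by rewrite big_geq // expr0 invr1 subrr.
by rewrite big_nat_recr //= IH exprS invfM; field; rewrite expf_neq0.
Qed.

(** Each term is at most 2^(-c_i) times the bound: with M = m + 1,
    m c_i + c_i = M c_i <= c_i^2 + M^2, and 2^(-c_i^2) cancels the first square. *)
Lemma normc_CS_f_le z w m : normc z <= 2 ^+ m -> 1 + normc w <= 2 ^+ m ->
  normc (CS_f c z w) <= 3 * 2 ^+ ('C(m.+1, 2) + m.+1 ^ 2).
Proof.
move=> zm wm; apply: normc_lim_le => n; apply: le_trans (normc_sum _ _ _) _.
have p_gt0 k : 0 < 2 ^+ k :> R by rewrite exprn_gt0.
(* As c_i >= i, the sum is at most B times the sum of the 2^(-i), i >= 1. *)
set B : R := 3 * _; have B_ge0 : 0 <= B by rewrite mulr_ge0 // ltW.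
rewrite -[B]mulr1; apply: le_trans (ler_wpM2l B_ge0 (sum_halves_le1 n)).
rewrite mulr_sumr !big_nat; apply: ler_sum => i /andP[i_gt0 _].
rewrite !normcM normcV normcX normc_nat.
have P_le : normc (CS_P (c i) w) <= 2 ^+ (m * c i).
  apply: le_trans (normc_CS_P_le _ _) _; rewrite exprM lerXn2r // nnegrE.
  - by rewrite addr_ge0 // normc_ge0.
  - exact: ltW (p_gt0 m).
have step : normc (CS_gk i z) * normc (CS_P (c i) w) <=
    3 * 2 ^+ 'C(m.+1, 2) * 2 ^+ (m * c i).
  by apply: ler_pM; rewrite ?normc_ge0 //; exact: normc_CS_gk_le.
have key : 2 ^+ (m * c i) * 2 ^+ i <= 2 ^+ (m.+1 ^ 2) * 2 ^+ (c i ^ 2) :> R.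
  by rewrite -!exprD ler_weXn2l ?ler1n //; have := leq_c i_gt0; nia.
rewrite -mulrA mulrC ler_pdivrMr //; apply: le_trans step _.
rewrite [B * _ * _]mulrAC ler_pdivlMr // /B exprD mulrA -!(mulrA (3 * _)).
by rewrite ler_wpM2l // mulr_ge0 // ltW.
Qed.

End Map.

Lemma enorm_le_add (p : CC R * CC R) : enorm p <= normc p.1 + normc p.2.
Proof.
have p1 := normc_ge0 p.1; have p2 := normc_ge0 p.2.
rewrite -[leRHS]ger0_norm ?addr_ge0 // -sqrtr_sqr ler_wsqrtr //.
by rewrite sqrrD lerD2r lerDl mulrn_wge0 // mulr_ge0.
Qed.

Lemma normc_fst_le_enorm (p : CC R * CC R) : normc p.1 <= enorm p.
Proof.
by rewrite -[leLHS]ger0_norm ?normc_ge0 // -sqrtr_sqr ler_wsqrtr // lerDl sqr_ge0.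
Qed.

Lemma normc_snd_le_enorm (p : CC R * CC R) : normc p.2 <= enorm p.
Proof.
by rewrite -[leLHS]ger0_norm ?normc_ge0 // -sqrtr_sqr ler_wsqrtr // lerDr sqr_ge0.
Qed.

End CornalbaShiffman.

(** * Growth of the maximum modulus *)

Section Growth.
Variables (R : realType) (c : nat -> nat).
Hypothesis c_gt0 : forall i : nat, (1 <= i)%N -> (0 < c i)%N.
Hypothesis c_incr : forall i j : nat, (1 <= i)%N -> (i < j)%N -> (c i < c j)%N.
Implicit Types (r x y : R) (m n : nat).

Let F : CC R * CC R -> CC R * CC R := CS_map c.

Lemma enorm_CS_map_le (p : CC R * CC R) m : 1 + enorm p <= 2 ^+ m ->
  enorm (F p) <= 2 ^+ (m ^ 2 + m.+1 ^ 2 + 3).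
Proof.
move=> pm; have p1 := normc_fst_le_enorm p; have p2 := normc_snd_le_enorm p.
apply: le_trans (enorm_le_add _) _ => /=.
have g_le : normc (CS_g p.1) <= 3 * 2 ^+ 'C(m.+1, 2).
  by apply: normc_CS_g_le; lra.
have f_le : normc (CS_f c p.1 p.2) <= 3 * 2 ^+ ('C(m.+1, 2) + m.+1 ^ 2).
  by apply: normc_CS_f_le => //; lra.
have C_le : ('C(m.+1, 2) <= m ^ 2)%N.
  by have := mul_bin_diag m.+1 1; rewrite /= bin1 -mulnn; nia.
apply: le_trans (lerD g_le f_le) _; rewrite [leRHS]exprD.
have le1 : 2 ^+ 'C(m.+1, 2) <= 2 ^+ (m ^ 2 + m.+1 ^ 2) :> R.
  by rewrite ler_weXn2l ?ler1n // (leq_trans C_le) // leq_addr.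
have le2 : 2 ^+ ('C(m.+1, 2) + m.+1 ^ 2) <= 2 ^+ (m ^ 2 + m.+1 ^ 2) :> R.
  by rewrite ler_weXn2l ?ler1n // leq_add2r.
have p_gt0 : 0 < 2 ^+ (m ^ 2 + m.+1 ^ 2) :> R by rewrite exprn_gt0.
by move: le1 le2 p_gt0; rewrite (_ : 2 ^+ 3 = 8); [lra|ring].
Qed.

Lemma ubound_maxmod r m : 1 + r <= 2 ^+ m ->
  ubound [set enorm (F p) | p in eball r] (2 ^+ (m ^ 2 + m.+1 ^ 2 + 3)).
Proof.
move=> rm _ [p pr <-]; apply: enorm_CS_map_le; apply: le_trans rm.
by rewrite lerD2l.
Qed.

Lemma enorm_axis x : enorm (toCC x, 0 : CC R) = `|x|.
Proof. by rewrite /enorm normc_real normc0 expr0n addr0 sqrtr_sqr normr_id. Qed.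

Lemma maxmod_le r m : 0 <= r -> 1 + r <= 2 ^+ m ->
  maxmod F r <= 2 ^+ (m ^ 2 + m.+1 ^ 2 + 3).
Proof.
move=> r_ge0 rm; apply: ge_sup (ubound_maxmod rm).
exists (enorm (F (toCC 0, 0))), (toCC 0, 0) => //.
by rewrite /eball /= enorm_axis normr0.
Qed.

Lemma maxmod_ge r m : 3 * 2 ^+ m <= r -> 2 ^+ 'C(m.+1, 2) / 32 <= maxmod F r.
Proof.
move=> mr; have m_ge0 : 0 <= 3 * 2 ^+ m :> R by rewrite mulr_ge0 ?exprn_ge0.
pose p : CC R * CC R := (toCC (3 * 2 ^+ m), 0).
have [n rn] := exists_pow2_ge (1 + r).
apply: le_trans (_ : enorm (F p) <= _).
  apply: le_trans (normc_fst_le_enorm _); apply: normc_CS_g_circle_ge.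
  by rewrite normc_real ger0_norm.
apply: ub_le_sup; first by exists (2 ^+ (n ^ 2 + n.+1 ^ 2 + 3)); exact: ubound_maxmod.
by exists p => //; rewrite /eball /= enorm_axis ger0_norm.
Qed.

Lemma ln2_gt0 : 0 < ln 2 :> R.
Proof. by rewrite ln_gt0 // ltr1n. Qed.

Lemma log2X n : log2 (2 ^+ n : R) = n%:R.
Proof.
by rewrite /log2 lnXn // -(mulr_natl (ln 2)) mulfK // gt_eqF // ln2_gt0.
Qed.

Lemma ler_log2 x y : 0 < x -> x <= y -> log2 x <= log2 y.
Proof.
move=> x_gt0 xy; rewrite ler_wpM2r ?invr_ge0 ?(ltW ln2_gt0) //.
by rewrite ler_ln // posrE // (lt_le_trans x_gt0).
Qed.

Lemma ltr_log2 x y : 0 < x -> x < y -> log2 x < log2 y.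
Proof.
move=> x_gt0 xy; rewrite ltr_pM2r ?invr_gt0 ?ln2_gt0 //.
by rewrite ltr_ln // posrE // (lt_trans x_gt0).
Qed.

Lemma log2_pow_le r m : 1 <= r -> m%:R <= log2 r -> 2 ^+ m <= r.
Proof.
move=> r_ge1 mr; rewrite leNgt; apply/negP => rm.
have := ltr_log2 (lt_le_trans ltr01 r_ge1) rm.
by rewrite log2X ltNge mr.
Qed.

(** The integral part of log r provides the dyadic scale on which every estimate
    is made. *)
Lemma log2_dyadic_bracket r : 1 <= r ->
  exists2 m, 2 ^+ m <= r < 2 ^+ m.+1 & m%:R <= log2 r < m.+1%:R.
Proof.
move=> r_ge1; have l_ge0 : 0 <= log2 r.
  by rewrite -[0]/(0%:R) -log2X ler_log2 ?expr0.
have /andP[ml lm] := truncn_itv l_ge0.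
exists (Num.truncn (log2 r)); last by rewrite ml lm.
rewrite log2_pow_le //= ltNge; apply/negP => /(ler_log2 _).
by rewrite log2X leNgt lm exprn_gt0 // => /(_ isT).
Qed.

(** With L = log r and m its integral part, log of the maximum modulus is at
    least (m - 1)(m - 2)/2 - 5 and at most (m + 2)^2 + (m + 3)^2 + 3.  As
    L - 1 < m <= L, the constants 1/20 and 28 are good enough once L >= 10. *)
Lemma log2_maxmod_bounds r : 2 ^+ 10 <= r ->
  log2 r ^+ 2 / 20 <= log2 (maxmod F r) <= 28 * log2 r ^+ 2.
Proof.
move=> r_large; have r_ge1 : 1 <= r.
  by apply: le_trans r_large; rewrite exprn_ege1 // ler1n.
have l_ge10 : 10 <= log2 r.
  by rewrite -[10]/(10%:R) -log2X ler_log2 ?exprn_gt0.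
have [m /andP[mr rm] /andP[ml lm]] := log2_dyadic_bracket r_ge1.
have m_gt9 : (9 < m)%N.
  rewrite ltnNge; apply/negP => m9.
  have : m.+1%:R <= 10 :> R by rewrite (ler_nat _ _ 10).
  lra.
have p_gt0 k : 0 < 2 ^+ k :> R by rewrite exprn_gt0.
have max_ge : 2 ^+ 'C(m.-1, 2) / 32 <= maxmod F r.
  have -> : m.-1 = (m - 2).+1 by lia.
  (* The circle of radius 3 * 2^(m-2) is the largest one that fits below 2^m. *)
  apply: maxmod_ge; apply: le_trans mr.
  have -> : 2 ^+ m = 4 * 2 ^+ (m - 2) :> R.
    by rewrite -{1}(subnK (_ : 2 <= m)%N) 1?exprD; [ring|lia].
  by have := p_gt0 (m - 2)%N; lra.
have max_gt0 : 0 < maxmod F r by apply: lt_le_trans max_ge; rewrite divr_gt0.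
apply/andP; split.
  have C5 : (5 <= 'C(m.-1, 2))%N.
    by have := mul_bin_diag m.-1 1; rewrite bin1; nia.
  have {}max_ge : 2 ^+ ('C(m.-1, 2) - 5) <= maxmod F r.
    apply: le_trans max_ge; rewrite ler_pdivlMr //.
    have -> : 32 = 2 ^+ 5 :> R by ring.
    by rewrite -exprD subnK.
  have := ler_log2 (p_gt0 _) max_ge; rewrite log2X; apply: le_trans.
  have CE : 2 * 'C(m.-1, 2)%:R = (m%:R - 1) * (m%:R - 2) :> R.
    rewrite -natrM -mul_bin_diag bin1 natrM.
    by rewrite -!subn1 -subnDA !natrB //; lia.
  rewrite natrB //; move: lm; rewrite -natr1 => lm.
  nra.
have max_le : maxmod F r <= 2 ^+ (m.+2 ^ 2 + m.+3 ^ 2 + 3).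
  apply: maxmod_le; first exact: le_trans r_ge1.
  by rewrite exprS; lra.
have := ler_log2 max_gt0 max_le; rewrite log2X => /le_trans; apply.
rewrite !natrD !natrX -!natr1; nra.
Qed.

Lemma near_pinfty_ge (B : R) : \forall r \near pinfty_nbhs R, B <= r.
Proof. exact: nbhs_pinfty_ge (num_real B). Qed.

Lemma log2_maxmod_Theta :
  Theta_pinfty (fun r => log2 (maxmod F r)) (fun r => log2 r ^+ 2).
Proof.
have sq_ge0 r : 0 <= log2 r ^+ 2 by exact: sqr_ge0.
split; apply/eqO_exP.
- exists 28 => //; apply: filterS (near_pinfty_ge (2 ^+ 10)) => r.
  move=> /log2_maxmod_bounds; have := sq_ge0 r => ? ?.
  by rewrite !ger0_norm; lra.
- exists 20 => //; apply: filterS (near_pinfty_ge (2 ^+ 10)) => r.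
  move=> /log2_maxmod_bounds; have := sq_ge0 r => ? ?.
  by rewrite !ger0_norm; lra.
Qed.

End Growth.

(** * Counting the components that contain zeros *)

Lemma card_fset_set_le (T : choiceType) (A : set T) (s : seq T) :
  A `<=` [set` s] -> (#|` fset_set A| <= size s)%N.
Proof.
move=> As; have finA : finite_set A by apply: sub_finite_set As (finite_seq s).
apply: uniq_leq_size => [|x]; first exact: fset_uniq.
by rewrite in_fset_set // => /set_mem/As.
Qed.

Lemma card_fset_set_ge (T : choiceType) (A : set T) (s : seq T) :
  finite_set A -> uniq s -> [set` s] `<=` A -> (size s <= #|` fset_set A|)%N.
Proof.
move=> finA uniq_s sA; apply: uniq_leq_size => // x xs.
by rewrite in_fset_set //; apply: mem_set; exact: sA.
Qed.

Section Counting.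
Variables (R : realType) (c : nat -> nat).
Hypothesis c_gt0 : forall i : nat, (1 <= i)%N -> (0 < c i)%N.
Hypothesis c_incr : forall i j : nat, (1 <= i)%N -> (i < j)%N -> (c i < c j)%N.
Variables (delta : R) (delta_gt0 : 0 < delta).
Implicit Types (r t x : R) (j k m n : nat) (z : CC R) (p q : CC R * CC R).

Let F : CC R * CC R -> CC R * CC R := CS_map c.

Definition CS_zero k j : CC R * CC R := (2 ^+ k, toCC j%:R^-1).

Definition zero_components r : set (set (CC R * CC R)) :=
  [set K | components (sublevel F r delta) K /\ exists2 p, K p & F p = (0, 0)].

Lemma normc_zero_fst k j : normc (CS_zero k j).1 = 2 ^+ k.
Proof. by rewrite normcX normc_nat. Qed.

(** The bound 3 * 2^(k(k+1)/2) of g_k at 2^k is beaten by 2^(-c_k^2) because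
    c_k >= k; with P_(c_k) at most 1 on [0, 1], this leaves at most 6 / 2^k. *)
Lemma enorm_zero_slice_small :
  exists k0, forall k t, (k0 <= k)%N -> (0 < k)%N -> 0 <= t <= 1 ->
    enorm (F (2 ^+ k, toCC t)) <= delta.
Proof.
have [k0 k0P] := exists_pow2_ge (6 / delta); exists k0 => k t k0k k_gt0 t01.
have p_gt0 n : 0 < 2 ^+ n :> R by rewrite exprn_gt0.
apply: le_trans (enorm_le_add _) _ => /=.
have /eqP := (CS_g_eq0 (2 ^+ k : CC R)).2 (ex_intro2 _ _ k k_gt0 erefl).
rewrite -normc_eq0 => /eqP ->; rewrite add0r CS_f_pow2 // !normcM normcV normcX.
rewrite normc_nat -mulrA mulrC ler_pdivrMr //.
have gk_le : normc (CS_gk k (2 ^+ k : CC R)) <= 3 * 2 ^+ 'C(k.+1, 2).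
  by apply: normc_CS_gk_le; rewrite normcX normc_nat.
apply: le_trans (ler_pM (normc_ge0 _) (normc_ge0 _) gk_le (normc_CS_P_le1 _ t01)) _.
rewrite mulr1.
have le_exp : 2 ^+ 'C(k.+1, 2) * 2 ^+ k <= 2 * 2 ^+ (c k ^ 2) :> R.
  rewrite -exprD -exprS ler_weXn2l ?ler1n //.
  have kc := leq_c c_gt0 c_incr k_gt0; have := leq_mul kc kc.
  have k3 : (3 * k <= k * k + 2)%N by case: (k) => [|[|l]]; nia.
  by have := mul_bin_diag k.+1 1; rewrite /= bin1 -mulnn; lia.
have d_ge : 6 <= delta * 2 ^+ k.
  have : 2 ^+ k0 <= 2 ^+ k :> R by rewrite ler_weXn2l ?ler1n.
  move=> /(le_trans k0P); rewrite ler_pdivrMr //; lra.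
rewrite -(ler_pM2r (p_gt0 k)); have := p_gt0 (c k ^ 2)%N; nra.
Qed.

Lemma CS_g_large_circles :
  exists k1, forall m z, (k1 <= m)%N -> normc z = 3 * 2 ^+ m ->
    delta < normc (CS_g z).
Proof.
have [k1 k1P] := exists_pow2_ge (32 * delta + 1); exists k1 => m z k1m zm.
apply: lt_le_trans (normc_CS_g_circle_ge zm); rewrite ltr_pdivlMr //.
have : 2 ^+ k1 <= 2 ^+ 'C(m.+1, 2) :> R.
  by rewrite ler_weXn2l ?ler1n // binS bin1 (leq_trans k1m) // leq_addl.
lra.
Qed.

(** The segment joining the two zeros stays in the ball, because 1/c_k <= 1/j
    makes its points have smaller norm than the starting one. *)
Lemma connected_zero_segment r k j :
  (forall t, 0 <= t <= 1 -> enorm (F (2 ^+ k, toCC t)) <= delta) ->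
  (0 < j <= c k)%N -> eball r (CS_zero k j) ->
  connected_component (sublevel F r delta) (CS_zero k j) (CS_zero k (c k)).
Proof.
move=> small /andP[j_gt0 jc] jr; have c_gt0' := leq_trans j_gt0 jc.
pose I : set R := [set` `[(c k)%:R^-1, j%:R^-1]].
pose slice t : CC R * CC R := (2 ^+ k, toCC t).
have le_cj : (c k)%:R^-1 <= j%:R^-1 :> R by rewrite lef_pV2 ?posrE ?ltr0n // ler_nat.
apply: (@connected_component_max _ _ (slice @` I)).
- by exists j%:R^-1 => //; rewrite /I /= in_itv /= lexx le_cj.
- move=> _ [t + <-]; rewrite /I /= in_itv /= => /andP[ct tj].
  have t_ge0 : 0 <= t by rewrite (le_trans _ ct) // invr_ge0.
  split.
    apply: small; rewrite t_ge0 (le_trans tj) //.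
    by rewrite invf_le1 ?ler1n ?ltr0n.
  apply: le_trans jr; rewrite /enorm ler_wsqrtr // lerD2l !normc_real.
  by rewrite lerXn2r ?nnegrE // !ger0_norm // invr_ge0.
- apply: connected_continuous_connected.
    by apply/connected_intervalP; exact: interval_is_interval.
  apply: continuous_subspaceT => t.
  apply: (@cvg_pair _ _ _ (nbhs t) (nbhs (2 ^+ k : CC R)) (nbhs (toCC t))).
    exact: cvg_cst.
  exact: toCC_continuous.
- by exists (c k)%:R^-1 => //; rewrite /I /= in_itv /= lexx le_cj.
Qed.

(** |z| is continuous on C^2, so it takes intermediate values on connected sets. *)
Lemma connected_no_crossing (K : set (CC R * CC R)) (s : R) p q :
  connected K -> K p -> K q -> normc p.1 <= s <= normc q.1 ->
  exists2 o, K o & normc o.1 = s.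
Proof.
move=> Kc Kp Kq sP.
have /connected_intervalP itvK : connected ((fun o => normc o.1) @` K).
  apply: connected_continuous_connected => //; apply: continuous_subspaceT => o.
  by apply: (@continuous_comp _ _ _ fst); [exact: cvg_fst|exact: normc_continuous].
by have [||o Ko <-] := itvK (normc p.1) (normc q.1) _ _ s sP; [exists p|exists q|exists o].
Qed.

(** The list pays one component per zero for the finitely many slices below
    [k0], and one per slice for the others. *)
Lemma zero_components_sub_seq k0 r m :
  (forall k t, (k0 <= k)%N -> (0 < k)%N -> 0 <= t <= 1 ->
    enorm (F (2 ^+ k, toCC t)) <= delta) -> r < 2 ^+ m.+1 ->
  zero_components r `<=` [set`
    [seq connected_component (sublevel F r delta) (CS_zero k j)
      | k <- iota 1 k0, j <- iota 1 (c k)] ++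
    [seq connected_component (sublevel F r delta) (CS_zero k (c k))
      | k <- iota 1 m]].
Proof.
move=> small rm K [[x Ax <-] [p xp /CS_map_eq0[k [j [k_gt0 jc pE]]]]].
have {}pE : p = CS_zero k j by [].
have := connected_component_sub xp; rewrite pE => -[_ pr].
rewrite (same_connected_component xp) pE /= mem_cat; apply/orP.
have [ltkk0|lek0k] := ltnP k k0.
  left; apply/allpairsPdep; exists k, j; split => //; first last.
    by rewrite mem_iota add1n ltnS.
  by rewrite mem_iota k_gt0 add1n ltnS ltnW.
right; apply/mapP; exists k.
  rewrite mem_iota k_gt0 add1n ltnNge; apply/negP => ltmk.
  have := le_lt_trans (le_trans (normc_fst_le_enorm _) pr) rm.
  by rewrite normc_zero_fst ltNge ler_weXn2l ?ler1n.
have joined : connected_component (sublevel F r delta)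
    (CS_zero k j) (CS_zero k (c k)).
  by apply: connected_zero_segment => // t; exact: small.
exact: (same_connected_component joined).
Qed.

Lemma eball_zero r k : (0 < k)%N -> 2 ^+ k + 1 <= r -> eball r (CS_zero k (c k)).
Proof.
move=> k_gt0; apply: le_trans; apply: le_trans (enorm_le_add _) _.
rewrite normc_zero_fst lerD2l normc_real ger0_norm ?invr_ge0 //.
by rewrite invf_le1 ?ler1n ?ltr0n c_gt0.
Qed.

(** Two zeros on the slices k < l are separated by the hypersurface
    |z| = 3 * 2^(k-1), where |g| alone exceeds [delta]. *)
Lemma zero_components_separated k1 r m :
  (forall n z, (k1 <= n)%N -> normc z = 3 * 2 ^+ n -> delta < normc (CS_g z)) ->
  2 ^+ m.+1 <= r ->
  let s := [seq connected_component (sublevel F r delta) (CS_zero k (c k))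
             | k <- iota k1.+1 (m - k1)] in
  uniq s /\ [set` s] `<=` zero_components r.
Proof.
move=> large mr s.
have in_sub k : k \in iota k1.+1 (m - k1) ->
    sublevel F r delta (CS_zero k (c k)) /\ F (CS_zero k (c k)) = (0, 0).
  rewrite mem_iota => /andP[k1k km].
  have k_gt0 : (0 < k)%N by lia.
  have Fk : F (CS_zero k (c k)) = (0, 0).
    by apply/CS_map_eq0; exists k, (c k); split; rewrite // leqnn c_gt0.
  split => //; split.
    have e0 : enorm (0 : CC R, 0 : CC R) = 0.
      by apply: etrans (enorm_axis 0) _; rewrite normr0.
    by rewrite /= Fk e0 ltW.
  apply: eball_zero => //; apply: le_trans mr; rewrite exprS.
  have km' : (k <= m)%N by lia.
  have : 2 ^+ k <= 2 ^+ m :> R by rewrite ler_weXn2l ?ler1n.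
  have : 1 <= 2 ^+ m :> R by rewrite exprn_ege1 // ler1n.
  lra.
split; last first.
  move=> K /mapP[k /in_sub[Ak Fk] ->]; split; first by exists (CS_zero k (c k)).
  by exists (CS_zero k (c k)) => //; exact: connected_component_refl.
have no_join k l : k \in iota k1.+1 (m - k1) -> l \in iota k1.+1 (m - k1) ->
    (k < l)%N -> connected_component (sublevel F r delta) (CS_zero k (c k)) <>
    connected_component (sublevel F r delta) (CS_zero l (c l)).
  move=> ks ls ltkl ccE.
  have [Ak _] := in_sub _ ks; have [Al _] := in_sub _ ls.
  have Kk := connected_component_refl Ak.
  have Kl := connected_component_refl Al; rewrite -ccE in Kl.
  move: ks; rewrite mem_iota => /andP[k1k _].
  have k_gt0 : (0 < k)%N by lia.
  have kE : 2 ^+ k = 2 * 2 ^+ k.-1 :> R by rewrite -exprS prednK.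
  have p_gt0 : 0 < 2 ^+ k.-1 :> R by rewrite exprn_gt0.
  have kl : 2 * 2 ^+ k <= 2 ^+ l :> R by rewrite -exprS ler_weXn2l ?ler1n.
  have Kc := @component_connected _ (sublevel F r delta) (CS_zero k (c k)).
  have [|o Ko] := @connected_no_crossing _ (3 * 2 ^+ k.-1) _ _ Kc Kk Kl.
    by rewrite !normc_zero_fst; lra.
  have k1k' : (k1 <= k.-1)%N by lia.
  move=> /(large _ _ k1k'); have [oF _] := connected_component_sub Ko.
  by rewrite ltNge (le_trans _ oF) //; exact: (normc_fst_le_enorm (F o)).
rewrite map_inj_in_uniq ?iota_uniq // => k l ks ls ccE.
by case: (ltngtP k l) => // [/no_join|/no_join] H; case: (H _ _).
Qed.

(** The lower bound loses the slices up to [k1] and the slice m itself, whose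
    zeros may lie outside of the ball. *)
Lemma coarse_zeros_log2 : exists D : R, forall r, 2 <= r ->
  `|(coarse_zeros F r delta)%:R - log2 r| <= D.
Proof.
have [k0 small] := enorm_zero_slice_small.
have [k1 large] := CS_g_large_circles.
(* C counts the zeros on the slices 1, ..., k0. *)
set C := size [seq (k, j) | k <- iota 1 k0, j <- iota 1 (c k)].
exists (C%:R + k1%:R + 2) => r r_ge2; have r_ge1 : 1 <= r by lra.
have [m /andP[mr rm] /andP[ml lm]] := log2_dyadic_bracket r_ge1.
have sub := zero_components_sub_seq small rm.
have fin : finite_set (zero_components r) by apply: sub_finite_set sub (finite_seq _).
have upper : (coarse_zeros F r delta <= C + m)%N.
  apply: leq_trans (card_fset_set_le sub) _.
  by rewrite size_cat size_map size_iota leq_add2r /C !size_allpairs_dep.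
have lower : (m.-1 - k1 <= coarse_zeros F r delta)%N.
  have m_gt0 : (0 < m)%N.
    rewrite lt0n; apply/eqP => m0; move: rm; rewrite m0 expr1; lra.
  have mr' : 2 ^+ m.-1.+1 <= r by rewrite prednK.
  have [uniq_s sS] := zero_components_separated large mr'.
  apply: leq_trans (card_fset_set_ge fin uniq_s sS).
  by rewrite size_map size_iota.
have lower' : (m <= coarse_zeros F r delta + k1 + 1)%N by lia.
move: upper lower' lm; rewrite -!(ler_nat R) -natr1 !natrD.
have := ler0n R C; have := ler0n R k1.
by rewrite ler_norml; lra.
Qed.

Lemma coarse_zeros_sim :
  sim_pinfty (fun r => (coarse_zeros F r delta)%:R) (fun r => log2 r).
Proof.
have [D DP] := coarse_zeros_log2.
apply/cvgrPdist_le => e e_gt0.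
have [n nP] := exists_pow2_ge (`|D| / e).
(* On this range log r exceeds 2^n, hence D / e. *)
apply: filterS (near_pinfty_ge (2 ^+ (2 ^ n).+1)) => r r_large.
have r_ge2 : 2 <= r.
  by apply: le_trans r_large; rewrite exprS ler_peMr // exprn_ege1 // ler1n.
have l_ge : (2 ^ n).+1%:R <= log2 r by rewrite -log2X ler_log2 ?exprn_gt0.
have n_gt0 : 0 < (2 ^ n)%:R :> R by rewrite ltr0n expn_gt0.
rewrite -natr1 in l_ge; have l_gt0 : 0 < log2 r by lra.
have normE x : 1 - x / log2 r = (log2 r - x) / log2 r.
  by rewrite mulrBl divff // gt_eqF.
rewrite normE normrM distrC normfV (gtr0_norm l_gt0) ler_pdivrMr //.
apply: le_trans (DP r r_ge2) _; apply: le_trans (ler_norm _) _.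
move: nP; rewrite ler_pdivrMr // -natrX mulrC => /le_trans; apply.
by rewrite ler_wpM2l ?ltW //; lra.
Qed.

End Counting.

(** * Growth and number of coarse zeros *)

Theorem theorem1p5 (R : realType) (c : nat -> nat)
    (c_gt0 : forall i : nat, (1 <= i)%N -> (0 < c i)%N)
    (c_incr : forall i j : nat, (1 <= i)%N -> (i < j)%N -> (c i < c j)%N) :
  Theta_pinfty (fun r : R => log2 (maxmod (@CS_map R c) r))
               (fun r : R => log2 r ^+ 2) /\
  (forall delta : R, 0 < delta ->
     sim_pinfty (fun r : R => (coarse_zeros (@CS_map R c) r delta)%:R)
                (fun r : R => log2 r)).
Proof.
split; first exact: log2_maxmod_Theta.
by move=> delta delta_gt0; exact: coarse_zeros_sim.
Qed.
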